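(* Let $H$ be the graph on vertex set $\{0,1,2,3\}$ with red edge set $\{\{0,2\}\}$ and blue edge set $\{\{0,1\},\{0,3\},\{1,3\}\}$. Then $\lambda_H=1/8$, and this value is attained asymptotically by complete bipartite graphs of order $n\to\infty$ with both parts of size $(1/2+o(1))n$. Moreover, if $(G_n)$ is a sequence of graphs with orders tending to infinity and $\lambda_H(G_n)\to\lambda_H$, and $F$ is a $5$-vertex graph whose induced density $p(F,G_n)$ is bounded below by a positive constant for all large $n$, then $F$ is complete bipartite or is obtained from a $4$-vertex complete bipartite graph by adding one isolated vertex.
   Context: All graphs are finite and simple; the order of a graph is its number of vertices. For a graph $H$ with $\kappa$ vertices whose edges are coloured red or blue and an uncoloured graph $G$ of order $n\ge\kappa$, an embedding of $H$ into $G$ is an injection $V(H)\to V(G)$ that maps red edges of $H$ to edges of $G$ and blue edges of $H$ to non-edges of $G$ (pairs of distinct non-adjacent vertices). $\Lambda_H(G)$ is the number of embeddings, $\lambda_H(G):=\Lambda_H(G)/\big(n(n-1)\cdots(n-\kappa+1)\big)$, $\lambda_H(n)$ is the maximum of $\lambda_H(G)$ over all graphs $G$ of order $n$, and $\lambda_H:=\lim_{n\to\infty}\lambda_H(n)$ (the limit exists). For a graph $F$ with $k$ vertices and a graph $G$ of order $n\ge k$, $p(F,G)$ is the number of $k$-subsets of $V(G)$ inducing a subgraph isomorphic to $F$, divided by $\binom nk$. A complete bipartite graph is a blowup of $K_2$: its vertex set is split into two parts, one of which may be empty, and two vertices are adjacent if and only if they are in different parts (so an edgeless graph counts as complete bipartite).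 *)

(* Defs.v *)
From HB Require Import structures.
From mathcomp Require Import all_boot all_order all_algebra.
From mathcomp Require Import all_classical all_reals all_analysis.

Set Implicit Arguments.
Unset Strict Implicit.
Unset Printing Implicit Defensive.

Import Order.TTheory GRing.Theory Num.Theory.
Import numFieldNormedType.Exports.

Local Open Scope ring_scope.

Definition is_sgraph (T : finType) (e : {ffun T * T -> bool}) : bool :=
  [forall x, ~~ e (x, x)] && [forall x, forall y, e (x, y) == e (y, x)].

Record sgraph (T : finType) := SGraph {
  sg_fun : {ffun T * T -> bool};
  _ : is_sgraph sg_fun }.

HB.instance Definition _ (T : finType) := [isSub for @sg_fun T].
HB.instance Definition _ (T : finType) := [Finite of sgraph T by <:].

Definition adj (T : finType) (G : sgraph T) : rel T :=
  fun x y => sg_fun G (x, y).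

Lemma is_sgraph_rel (T : finType) (r : rel T) :
  irreflexive r -> symmetric r -> is_sgraph [ffun u => r u.1 u.2].
Proof.
move=> rI rS; apply/andP; split; apply/forallP => x; first by rewrite ffunE rI.
by apply/forallP => y; rewrite !ffunE rS.
Qed.

Definition sgraph_of (T : finType) (r : rel T)
    (rI : irreflexive r) (rS : symmetric r) : sgraph T :=
  SGraph (is_sgraph_rel rI rS).

Lemma adj_sgraph_of (T : finType) (r : rel T)
    (rI : irreflexive r) (rS : symmetric r) : adj (sgraph_of rI rS) =2 r.
Proof. by move=> x y; rewrite /adj ffunE. Qed.

Lemma adj_irr (T : finType) (G : sgraph T) : irreflexive (adj G).
Proof.
by move=> x; have /andP[/forallP/(_ x)/negbTE] := valP G.
Qed.

Lemma adj_sym (T : finType) (G : sgraph T) : symmetric (adj G).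
Proof.
by move=> x y; have /andP[_ /forallP/(_ x)/forallP/(_ y)/eqP] := valP G.
Qed.

Section EdgeList.
Variables (n : nat) (s : seq (nat * nat)).

Definition edges_rel : rel 'I_n := fun x y =>
  (x != y) && (((val x, val y) \in s) || ((val y, val x) \in s)).

Lemma edges_rel_irr : irreflexive edges_rel.
Proof. by move=> x; rewrite /edges_rel eqxx. Qed.

Lemma edges_rel_sym : symmetric edges_rel.
Proof. by move=> x y; rewrite /edges_rel eq_sym orbC. Qed.

(** Each unordered pair may be listed in either orientation. *)
Definition edges_graph : sgraph 'I_n := sgraph_of edges_rel_irr edges_rel_sym.
End EdgeList.

Section CompleteBipartite.
Variables (T : finType) (A : {set T}).

Definition bip_rel : rel T := fun x y => (x \in A) != (y \in A).

Lemma bip_rel_irr : irreflexive bip_rel.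
Proof. by move=> x; rewrite /bip_rel eqxx. Qed.

Lemma bip_rel_sym : symmetric bip_rel.
Proof. by move=> x y; rewrite /bip_rel eq_sym. Qed.

(** The complete bipartite graph with parts [A] and [~: A]; either part may be
    empty. *)
Definition bip_graph : sgraph T := sgraph_of bip_rel_irr bip_rel_sym.
End CompleteBipartite.

Definition complete_bipartite (T : finType) (G : sgraph T) : Prop :=
  exists A : {set T}, G = bip_graph A.

Section AddIsolated.
Variables (T : finType) (G : sgraph T).

Definition add_isolated_rel : rel (option T) := fun u v =>
  if (u, v) is (Some x, Some y) then adj G x y else false.

Lemma add_isolated_rel_irr : irreflexive add_isolated_rel.
Proof. by case=> [x|] //=; exact: adj_irr. Qed.

Lemma add_isolated_rel_sym : symmetric add_isolated_rel.
Proof. by case=> [x|] [y|] //=; exact: adj_sym. Qed.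

(** The new isolated vertex is [None]. *)
Definition add_isolated : sgraph (option T) :=
  sgraph_of add_isolated_rel_irr add_isolated_rel_sym.
End AddIsolated.

Section Induced.
Variables (T : finType) (G : sgraph T) (S : {set T}).

Definition induced_rel : rel {x : T | x \in S} :=
  fun u v => adj G (val u) (val v).

Lemma induced_rel_irr : irreflexive induced_rel.
Proof. by move=> x; exact: adj_irr. Qed.

Lemma induced_rel_sym : symmetric induced_rel.
Proof. by move=> x y; exact: adj_sym. Qed.

Definition induced : sgraph {x : T | x \in S} :=
  sgraph_of induced_rel_irr induced_rel_sym.
End Induced.

Definition isomorphic (T U : finType) (F : sgraph T) (G : sgraph U) : Prop :=
  exists2 f : T -> U, bijective f & forall x y, adj G (f x) (f y) = adj F x y.

(** [p(F, G)] *)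
Definition induced_density (R : realType) (W T : finType)
    (F : sgraph W) (G : sgraph T) : R :=
  #|[pred S : {set T} |
      (#|S| == #|W|) && `[< isomorphic F (induced G S) >]]|%:R
  / 'C(#|T|, #|W|)%:R.

Record cgraph (T : finType) := CGraph {
  red : sgraph T;
  blue : sgraph T;
  _ : forall x y, ~~ (adj red x y && adj blue x y) }.

Definition embedding (U T : finType) (H : cgraph U) (G : sgraph T)
    (f : {ffun U -> T}) : bool :=
  [&& injectiveb f,
      [forall x, forall y, adj (red H) x y ==> adj G (f x) (f y)] &
      [forall x, forall y, adj (blue H) x y ==> ~~ adj G (f x) (f y)]].

(** [Lambda_H(G)] *)
Definition num_embeddings (U T : finType) (H : cgraph U) (G : sgraph T) : nat :=
  #|[pred f : {ffun U -> T} | embedding H G f]|.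

(** [lambda_H(G)] *)
Definition emb_density (R : realType) (U T : finType)
    (H : cgraph U) (G : sgraph T) : R :=
  (num_embeddings H G)%:R / (#|T| ^_ #|U|)%:R.

(** [lambda_H(n)]; the densities are nonnegative, so starting the iterated
    maximum at [0] is harmless. *)
Definition max_emb_density (R : realType) (U : finType) (H : cgraph U)
    (n : nat) : R :=
  \big[Num.max/0]_(G : sgraph 'I_n) emb_density R H G.

(** [lambda_H] *)
Definition inducibility (R : realType) (U : finType) (H : cgraph U) : R :=
  limn (max_emb_density R H).

Definition H4_red : sgraph 'I_4 := edges_graph 4 [:: (0, 2)]%N.
Definition H4_blue : sgraph 'I_4 := edges_graph 4 [:: (0, 1); (0, 3); (1, 3)]%N.

Lemma H4_disjoint x y : ~~ (adj H4_red x y && adj H4_blue x y).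
Proof.
rewrite !adj_sgraph_of.
by case: x => [[|[|[|[|x]]]] hx] //; case: y => [[|[|[|[|y]]]] hy].
Qed.

Definition H4 : cgraph 'I_4 := CGraph H4_disjoint.

(* Main.v *)
(** Let hom be the number of maps, injective or not, of the vertices of [H4] into
    the [n] vertices of [G] that respect both colours, so that hom / n^4 and
    lambda_H(G) differ by O(1/n).  The integer weight [certificate] of a 5-tuple
    of vertices is 80, minus 640 if four of its entries form a copy of [H4],
    minus products that add up, over all 5-tuples, to sums of squares: one
    square for each root vertex and two for each edge with a vertex
    non-adjacent to both its ends.  After averaging over the permutations of
    the tuple this weight vanishes on the complete bipartite graphs and on those
    with an isolated vertex added, and is positive on the other 5-vertex graphs,
    which is a check over 2^10 adjacency patterns.  Hence
      600 n hom + #(5-tuples inducing one of the other graphs) <= 75 n^5,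
    and this gives both lambda_H <= 1/8 and the description of the graphs [F] of
    positive density in a maximising sequence. *)

From Stdlib Require Import BinInt.
Require Import Defs.
From HB Require Import structures.
From mathcomp Require Import all_boot all_order all_algebra.
From mathcomp Require Import all_classical all_reals all_analysis.
From mathcomp Require Import ssrZ zify ring lra.
Import Order.TTheory GRing.Theory Num.Theory.
Import numFieldNormedType.Exports.

Set Implicit Arguments.
Unset Strict Implicit.
Unset Printing Implicit Defensive.

(** * A sum-of-squares certificate on five vertices *)

Section Certificate.
Local Open Scope Z_scope.

(** The weights are a rounded solution of the semidefinite program that bounds
    the density of [H4] by densities of 5-vertex graphs. *)
Definition cherry_weight (T : Type) (r : rel T) (x y z : T) : Z :=
  match r x y, r x z, r y z with
  | false, false, false | true, true, false => 4
  | true, true, true => -3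
  | false, false, true => -4
  | _, _, e => if e then -4 else -1
  end.

(** Such a triple never occurs in a complete bipartite graph, so the squares rooted at it vanish
    there. *)
Definition is_edge_plus_vertex (T : Type) (r : rel T) (x y z : T) : bool :=
  [&& r x y, ~~ r x z & ~~ r y z].

(** Exchanging [x] and [y] negates this weight and fixes [even_weight]: the two are the odd and even
    blocks for the symmetry of the root edge. *)
Definition skew_weight (T : Type) (r : rel T) (x y z v : T) : Z :=
  match r v x, r v y, r v z with
  | true, false, false => 1
  | false, true, false => -1
  | _, _, _ => 0
  end.

Definition even_weight (T : Type) (r : rel T) (x y z v : T) : Z :=
  match r v x, r v y, r v z with
  | false, false, false => 2
  | false, false, true => -5
  | true, false, true | false, true, true => -2
  | _, _, _ => 0
  end.

Definition H4_pattern (T : Type) (r : rel T) (x0 x1 x2 x3 : T) : bool :=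
  [&& r x0 x2, ~~ r x0 x1, ~~ r x0 x3 & ~~ r x1 x3].

(** The ratio 80 / 640 is the target 1/8. In each product the two factors share their root and use
    different remaining entries, so that summing over these entries gives a square. *)
Definition certificate (T : Type) (r : rel T) (x0 x1 x2 x3 x4 : T) : Z :=
  (80 - 640 * Z.b2z (H4_pattern r x0 x3 x1 x4)
   - 5 * (cherry_weight r x0 x1 x2 * cherry_weight r x0 x3 x4)
   - Z.b2z (is_edge_plus_vertex r x0 x1 x2) *
       (400 * (skew_weight r x0 x1 x2 x3 * skew_weight r x0 x1 x2 x4)
        + 16 * (even_weight r x0 x1 x2 x3 * even_weight r x0 x1 x2 x4))).

Definition cert_at (e : rel nat) (p : seq nat) : Z :=
  certificate e (nth 0%N p 0) (nth 0%N p 1) (nth 0%N p 2) (nth 0%N p 3) (nth 0%N p 4).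

(** A complete bipartite graph is determined by the edges at one vertex, here
    the first of [s]. *)
Definition bipartite_on (e : rel nat) (s : seq nat) : bool :=
  let x := head 0%N s in
  all (fun y => all (fun z => e y z == e x y (+) e x z) s) s.

(** The patterns on which the symmetrised [certificate] vanishes. *)
Definition sharp (e : rel nat) : bool :=
  bipartite_on e (iota 0 5) ||
  has (fun i => all (fun j => ~~ e i j) (iota 0 5)
                && bipartite_on e [seq bump i j | j <- iota 0 4]) (iota 0 5).

(** [certificate] is invariant under exchange of its last two vertices, hence
    half of the permutations suffice. *)
Definition half_perms : seq (seq nat) :=
  [seq p <- permutations (iota 0 5) | (nth 0%N p 3 < nth 0%N p 4)%N].

Definition pattern (b : seq bool) : rel nat := fun i j =>
  nth false (nth [::]
  [:: [:: false; nth false b 0; nth false b 1; nth false b 2; nth false b 3];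
      [:: nth false b 0; false; nth false b 4; nth false b 5; nth false b 6];
      [:: nth false b 1; nth false b 4; false; nth false b 7; nth false b 8];
      [:: nth false b 2; nth false b 5; nth false b 7; false; nth false b 9];
      [:: nth false b 3; nth false b 6; nth false b 8; nth false b 9; false]] i) j.

Fixpoint bitseqs (n : nat) : seq (seq bool) :=
  if n is n'.+1 then [seq b :: s | b <- [:: true; false], s <- bitseqs n']
  else [:: [::]].

(** A [foldr] over [Z] evaluates by computation, unlike the locked [\sum]. *)
Definition check_pattern (b : seq bool) : bool :=
  Z.leb (if sharp (pattern b) then 0 else 64)
    (foldr (fun p z => cert_at (pattern b) p + z) 0 half_perms).

End Certificate.

(** * Exhaustive check of the five-vertex patterns *)

Section CertificateSum.
Local Open Scope ring_scope.

Lemma check_all : all check_pattern (bitseqs 10).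
Proof. by vm_compute. Qed.

Lemma mem_bitseqs (b : seq bool) : b \in bitseqs (size b).
Proof.
elim: b => [|x b IHb] //=; rewrite cats0 mem_cat.
by case: x; rewrite map_f ?orbT.
Qed.

Lemma certificate_eq (e e' : rel nat) (n : nat) (p : seq nat) :
    (forall i j, (i < n)%N -> (j < n)%N -> e i j = e' i j) ->
    (forall k, nth 0%N p k < n)%N -> cert_at e p = cert_at e' p.
Proof.
move=> eqe pn.
rewrite /cert_at /certificate /H4_pattern /cherry_weight /is_edge_plus_vertex.
by rewrite /skew_weight /even_weight !eqe.
Qed.

Lemma half_perms_lt (p : seq nat) (k : nat) :
  p \in half_perms -> (nth 0 p k < 5)%N.
Proof.
rewrite mem_filter mem_permutations => /andP[_ p5].
have [kp|pk] := ltnP k (size p); last by rewrite nth_default.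
by have := mem_nth 0%N kp; rewrite (perm_mem p5) mem_iota.
Qed.

Lemma sharp_eq (e e' : rel nat) :
  (forall i j, (i < 5)%N -> (j < 5)%N -> e i j = e' i j) ->
  sharp e = sharp e'.
Proof. by move=> eqe; rewrite /sharp /bipartite_on /= !eqe. Qed.

(** On five indices a loopless symmetric relation is given by ten bits, so [check_all] covers every
    such [e]. *)
Lemma certificate_sum_ge (e : rel nat) :
    (forall i, (i < 5)%N -> e i i = false) ->
    (forall i j, (i < 5)%N -> (j < 5)%N -> e i j = e j i) ->
  ((if sharp e then 0 else 64%:R) <= \sum_(p <- half_perms) cert_at e p :> Z)%R.
Proof.
move=> eI eS.
pose b := [:: e 0 1; e 0 2; e 0 3; e 0 4; e 1 2; e 1 3; e 1 4; e 2 3; e 2 4;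
              e 3 4]%N.
have eqe i j : (i < 5)%N -> (j < 5)%N -> e i j = pattern b i j.
  case: i => [|[|[|[|[|i]]]]] //; case: j => [|[|[|[|[|j]]]]] // _ _;
    rewrite /pattern /= ?eI //; exact: eS.
rewrite (sharp_eq eqe) (eq_big_seq (cert_at (pattern b))); last first.
  by move=> p pP; apply: (@certificate_eq _ _ 5) => // k; exact: half_perms_lt.
have /seq.allP/(_ b (mem_bitseqs b)) := check_all.
have sumE (s : seq (seq nat)) (F : seq nat -> Z) :
  \sum_(p <- s) F p = foldr (fun p z => F p + z) 0 s by rewrite unlock.
by rewrite sumE /check_pattern; case: sharp.
Qed.

End CertificateSum.

(** * Averaging over tuples of vertices *)

Section Averaging.
Local Open Scope ring_scope.

Lemma big_tuple0 (V : nmodType) (T : finType) (F : seq T -> V) :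
  \sum_(t : 0.-tuple T) F t = F [::].
Proof.
by rewrite (big_pred1 [tuple]) // => t; apply/esym/eqP; exact: tuple0.
Qed.

Lemma big_tupleS (V : nmodType) (T : finType) (n : nat) (F : seq T -> V) :
  \sum_(t : n.+1.-tuple T) F t = \sum_x \sum_(t : n.-tuple T) F (x :: t).
Proof.
rewrite pair_big /=.
rewrite (reindex (fun u : T * n.-tuple T => [tuple of u.1 :: u.2])) //=.
exists (fun t => (thead t, [tuple of behead t])) => [[x t]|t] _ /=.
  by congr pair; apply: val_inj.
by rewrite -tuple_eta.
Qed.

(** Permuting positions is injective on the finite set of tuples, hence bijective. *)
Lemma big_tuple_perm (V : nmodType) (T : finType) (n : nat) (d : T)
    (p : seq nat) (F : seq T -> V) : perm_eq p (iota 0 n) ->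
  \sum_(t : n.-tuple T) F [seq nth d t i | i <- p] = \sum_(t : n.-tuple T) F t.
Proof.
move=> pn; have sp : size p = n by rewrite (perm_size pn) size_iota.
pose h (t : n.-tuple T) : n.-tuple T := tcast sp [tuple of [seq nth d t i | i <- in_tuple p]].
have hE t : tval (h t) = [seq nth d t i | i <- p] by rewrite /h val_tcast.
have h_inj : injective h.
  move=> t u /(congr1 (@tval n T)); rewrite !hE => /eq_in_map tu.
  apply: val_inj; apply: (@eq_from_nth _ d); rewrite ?size_tuple // => i lt_in.
  by apply: tu; rewrite (perm_mem pn) mem_iota.
by rewrite [RHS](reindex_inj h_inj); apply: eq_bigr => t _; rewrite hE.
Qed.

Lemma big_tuple4 (V : nmodType) (T : finType) (F : seq T -> V) :
  \sum_(t : 4.-tuple T) F t =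
  \sum_x0 \sum_x1 \sum_x2 \sum_x3 F [:: x0; x1; x2; x3].
Proof.
rewrite big_tupleS; apply: eq_bigr => x0 _.
rewrite (big_tupleS _ (fun s => F (x0 :: s))); apply: eq_bigr => x1 _.
rewrite (big_tupleS _ (fun s => F [:: x0, x1 & s])); apply: eq_bigr => x2 _.
rewrite (big_tupleS _ (fun s => F [:: x0, x1, x2 & s])); apply: eq_bigr => x3 _.
exact: (big_tuple0 (fun s => F [:: x0, x1, x2, x3 & s])).
Qed.

Lemma big_tuple5 (V : nmodType) (T : finType) (F : seq T -> V) :
  \sum_(t : 5.-tuple T) F t =
  \sum_x0 \sum_x1 \sum_x2 \sum_x3 \sum_x4 F [:: x0; x1; x2; x3; x4].
Proof.
rewrite big_tupleS; apply: eq_bigr => x0 _.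
exact: (big_tuple4 (fun s => F (x0 :: s))).
Qed.

Section TupleSum.
Variables (T : finType) (r : rel T) (d : T).
Hypotheses (rI : irreflexive r) (rS : symmetric r).

(** Entries of [t] may coincide: for irreflexive [r], copies of a vertex are non-adjacent, and the
    pattern is still loopless. Degenerate tuples thus cause no error term. *)
Definition pattern_of (t : seq T) : rel nat := fun i j => r (nth d t i) (nth d t j).

Let cert (t : seq T) : Z :=
  certificate r (nth d t 0) (nth d t 1) (nth d t 2) (nth d t 3) (nth d t 4).

Let H4_hom (t : seq T) : bool :=
  H4_pattern r (nth d t 0) (nth d t 1) (nth d t 2) (nth d t 3).

Lemma cert_atE (t : seq T) (p : seq nat) : size p = 5 ->
  cert_at (pattern_of t) p = cert [seq nth d t i | i <- p].
Proof. by move=> sp; rewrite /cert !(nth_map 0%N) ?sp. Qed.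

(** Each of the 60 permutations in [half_perms] gives the same total over all tuples, so the bound
    on each pattern can be summed. *)
Lemma cert_sum :
  \sum_(t : 5.-tuple T) (if sharp (pattern_of t) then 0 else 64%:R)
    <= (\sum_(t : 5.-tuple T) cert t) *+ 60 :> Z.
Proof.
rewrite [leRHS](_ : _ = \sum_(p <- half_perms) \sum_(t : 5.-tuple T) cert t); last first.
  by rewrite big_const_seq iter_addr_0 count_predT.
have -> : \sum_(p <- half_perms) \sum_(t : 5.-tuple T) cert t =
          \sum_(p <- half_perms) \sum_(t : 5.-tuple T) cert_at (pattern_of t) p.
  rewrite big_seq [RHS]big_seq; apply: eq_bigr => p.
  rewrite mem_filter mem_permutations => /andP[_ p5].
  rewrite -(big_tuple_perm d cert p5); apply: eq_bigr => t _.
  by rewrite cert_atE // (perm_size p5) size_iota.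
rewrite exchange_big; apply: ler_sum => t _.
by apply: certificate_sum_ge => [i _|i j _ _]; rewrite /pattern_of // rS.
Qed.

Let Q (t : seq T) : Z :=
  (cherry_weight r (nth d t 0) (nth d t 1) (nth d t 2)
  * cherry_weight r (nth d t 0) (nth d t 3) (nth d t 4))%R.

Let E (w : forall T : Type, rel T -> T -> T -> T -> T -> Z) (t : seq T) : Z :=
  ((is_edge_plus_vertex r (nth d t 0) (nth d t 1) (nth d t 2))%:R *
  (w T r (nth d t 0) (nth d t 1) (nth d t 2) (nth d t 3)
   * w T r (nth d t 0) (nth d t 1) (nth d t 2) (nth d t 4)))%R.

Lemma certE (t : seq T) : cert t =
  80%:R - 640%:R * (H4_pattern r (nth d t 0) (nth d t 3) (nth d t 1) (nth d t 4))%:R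
  - 5%:R * Q t - 400%:R * E skew_weight t - 16%:R * E even_weight t.
Proof.
rewrite /cert /certificate /Q /E -[RHS]addrA -opprD.
have bE (b : bool) (x : Z) : b%:R * x = if b then x else 0.
  by case: b; rewrite ?mul1r ?mul0r.
rewrite !bE; case: is_edge_plus_vertex; first by rewrite Z.mul_1_l; case: H4_pattern.
by rewrite !mulr0; case: H4_pattern.
Qed.

(** For a fixed root the other entries form two independent pairs, whence a square. Its base is 0 on
    a balanced complete bipartite graph, where the weight is 4 for a pair inside one part and -4
    otherwise. *)
Lemma Q_sum_ge0 : 0 <= \sum_(t : 5.-tuple T) Q t.
Proof.
rewrite big_tuple5; apply: sumr_ge0 => x _; rewrite /Q /=.
rewrite [leRHS](_ : _ = ((\sum_y \sum_z cherry_weight r x y z) ^+ 2)%R) ?sqr_ge0 //.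
rewrite expr2 mulr_suml; apply: eq_bigr => y _.
rewrite mulr_suml; apply: eq_bigr => z _.
rewrite mulr_sumr; apply: eq_bigr => u _.
by rewrite mulr_sumr.
Qed.

(** Once the root triple is fixed, the last two entries are independent, whatever the weight [w]. *)
Lemma E_sum_ge0 w : 0 <= \sum_(t : 5.-tuple T) E w t.
Proof.
rewrite big_tuple5; do 3![apply: sumr_ge0 => ? _]; rewrite /E /=.
set b := _%:R; set f := w T r _ _ _.
rewrite [leRHS](_ : _ = (b * (\sum_v f v) ^+ 2)%R).
  by apply: mulr_ge0; rewrite ?ler0n ?sqr_ge0.
rewrite expr2 mulr_suml mulr_sumr; apply: eq_bigr => v _.
by rewrite !mulr_sumr.
Qed.

Lemma H4_sum5 : \sum_(t : 5.-tuple T)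
    (H4_pattern r (nth d t 0) (nth d t 3) (nth d t 1) (nth d t 4))%:R =
  (#|T| * \sum_(t : 4.-tuple T) H4_hom t)%N%:R :> Z.
Proof.
pose F (s : seq T) : Z :=
  ((H4_pattern r (nth d s 0) (nth d s 3) (nth d s 1) (nth d s 4))%:R)%R.
(* Position 2 is free in the pattern; [p] fills it with the first entry, which yields the factor
   [#|T|], and positions 0, 3, 1, 4 with the others in order. *)
pose p := [:: 1; 3; 0; 2; 4]%N.
rewrite -(@big_tuple_perm _ _ 5 d p F) //.
rewrite (big_tupleS _ (fun s => F [seq nth d s i | i <- p])) /F /=.
by rewrite sumr_const natrM natr_sum mulr_natl.
Qed.

Lemma cert_le : \sum_(t : 5.-tuple T) cert t <=
  80%:R * (#|T| ^ 5)%N%:R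
  - 640%:R * (#|T| * \sum_(t : 4.-tuple T) H4_hom t)%N%:R.
Proof.
under eq_bigr do rewrite certE.
rewrite !sumrB -!mulr_sumr H4_sum5 sumr_const card_tuple -[80%:R *+ _]mulr_natr.
rewrite -!addrA lerD2l gerDl -!opprD oppr_le0.
by do 2?apply: addr_ge0; apply: mulr_ge0; rewrite ?ler0n ?E_sum_ge0 ?Q_sum_ge0.
Qed.

(** Combines [cert_sum] with [cert_le] and divides by 64: 60 * 80 / 64 = 75 and 60 * 640 / 64 =
    600. *)
Lemma nonsharp_count :
  (\sum_(t : 5.-tuple T) ~~ sharp (pattern_of t)
     + 600 * (#|T| * \sum_(t : 4.-tuple T) H4_hom t) <= 75 * #|T| ^ 5)%N.
Proof.
have sumE : \sum_(t : 5.-tuple T) (if sharp (pattern_of t) then 0 else 64%:R)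
    = (64 * \sum_(t : 5.-tuple T) ~~ sharp (pattern_of t))%N%:R :> Z.
  rewrite big_distrr /= natr_sum; apply: eq_bigr => t _.
  by case: sharp; rewrite ?muln0 ?muln1.
have := le_trans cert_sum (ler_wMn2r 60 cert_le).
rewrite sumE -[X in _ <= X]mulr_natr mulrBl -!natrM lerBrDr -natrD ler_nat => h.
move: h; set B := (\sum_(t : 5.-tuple T) _)%N; set L := (#|T| * _)%N.
by set m := (#|T| ^ 5)%N; lia.
Qed.
End TupleSum.

End Averaging.

(** * The graphs on which the certificate vanishes *)

Lemma bipartite_onP (e : rel nat) (s : seq nat) :
  reflect {in s &, forall i j, e i j = e (head 0%N s) i (+) e (head 0%N s) j}
          (bipartite_on e s).
Proof.
apply: (iffP seq.allP) => [h i j si sj|h i si].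
  by have /seq.allP/(_ j sj)/eqP := h i si.
by apply/seq.allP => j sj; rewrite h.
Qed.

Section Sharp.
Variables (W : finType) (F : sgraph W) (d : W).
Hypothesis W5 : #|W| = 5%N.
Let e := pattern_of (adj F) d (enum W).
Let rank (w : W) : 'I_5 := cast_ord W5 (enum_rank w).

Let e_rank x y : e (rank x) (rank y) = adj F x y.
Proof. by rewrite /e /pattern_of /= !nth_enum_rank. Qed.

Lemma sharp_classification : sharp e ->
  complete_bipartite F \/
  exists2 K : sgraph 'I_4, complete_bipartite K & isomorphic F (add_isolated K).
Proof.
have rankP w : val (rank w) \in iota 0 5 by rewrite mem_iota ltn_ord.
case/orP => [/bipartite_onP eb|/hasP[i]].
  (* One part is the neighbourhood of the vertex of rank 0. *)
  left; exists [set w | e 0 (rank w)].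
  apply: val_inj; apply/ffunP => -[x y]; rewrite ffunE /= /bip_rel !inE.
  rewrite -[LHS]/(adj F x y) -e_rank (eb _ _ (rankP x) (rankP y)) /=.
  by case: (e _ _); case: (e _ _).
rewrite mem_iota => /andP[_ lti] /andP[/seq.allP isol /bipartite_onP eb].
(* The least index other than the isolated [i] is [h]; its neighbours, renumbered by [lift i0], form
   one part of the four-vertex graph. *)
pose i0 := Ordinal lti; pose h := bump i 0.
pose A : {set 'I_4} := [set a | e h (lift i0 a)].
right; exists (bip_graph A); first by exists A.
have liftP (a : 'I_4) : val (lift i0 a) \in [seq bump i j | j <- iota 0 4].
  by apply/mapP; exists (val a) => //; rewrite mem_iota add0n /=.
exists (fun w => unlift i0 (rank w)).
  exists (fun u => enum_val (cast_ord (esym W5) (if u is Some a then lift i0 a else i0))).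
    by move=> w; case: unliftP => [a|] <-; rewrite cast_ordK enum_rankK.
  move=> u; rewrite /rank enum_valK cast_ordKV.
  by case: u => [a|]; rewrite ?liftK ?unlift_none.
move=> x y; rewrite adj_sgraph_of -e_rank /add_isolated_rel.
have isolS j : j \in iota 0 5 -> e j i = false.
  by move=> j5; rewrite /e /pattern_of adj_sym; apply/negbTE/isol.
case: unliftP => [a ->|->]; last by apply/esym/negbTE/isol/rankP.
case: unliftP => [b ->|->]; last first.
  by apply/esym/isolS; rewrite mem_iota ltn_ord.
rewrite adj_sgraph_of /bip_rel !inE (eb _ _ (liftP a) (liftP b)).
by rewrite -/h; case: (e _ _); case: (e _ _).
Qed.
End Sharp.

(** Listing a copy of [F] in the order of [enum W] gives a tuple with the pattern of [F], and the
    tuple determines the vertex set. *)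
Lemma induced_copies_le (W T : finType) (F : sgraph W) (G : sgraph T) (d : W) (d' : T) :
    #|W| = 5%N -> ~~ sharp (pattern_of (adj F) d (enum W)) ->
  (#|[pred S : {set T} | (#|S| == #|W|) && `[< isomorphic F (Defs.induced G S) >]]|
    <= \sum_(t : 5.-tuple T) ~~ sharp (pattern_of (adj G) d' t))%N.
Proof.
move=> W5 nsF.
rewrite -big_mkcond sum1_card.
pose U := [pred t : 5.-tuple T | ~~ sharp (pattern_of (adj G) d' t)].
apply: leq_trans (leq_imset_card (fun t : 5.-tuple T => [set x in t]) U).
apply: subset_leq_card; apply/fintype.subsetP => S /andP[/eqP S5 /asboolP[f [g fK gK] fadj]].
have sW : size (enum W) == 5%N by rewrite -cardE W5.
pose t := map_tuple (val \o f) (Tuple sW).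
apply/imsetP; exists t.
  rewrite inE; apply: contra nsF; rewrite (@sharp_eq _ (pattern_of (adj F) d (enum W))) //.
  have nth_t i : (i < 5)%N -> nth d' t i = val (f (nth d (enum W) i)).
    by move=> lti; rewrite /t /= (nth_map d) // (eqP sW).
  move=> i j lti ltj; rewrite /pattern_of !nth_t //.
  by rewrite -fadj adj_sgraph_of.
apply/finset.setP => x; rewrite inE; apply/idP/mapP => [Sx|[w _ ->]]; last exact: valP.
by exists (g (exist _ x Sx)); rewrite ?mem_enum //= gK.
Qed.

(** * Colour-preserving maps of [H4] *)

Definition num_homs (T : finType) (r : rel T) (d : T) : nat :=
  \sum_(t : 4.-tuple T) H4_pattern r (nth d t 0) (nth d t 1) (nth d t 2) (nth d t 3).

(** The literals of [H4_pattern] are the one red and three blue pairs of [H4], in one orientation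
    each; symmetry of [adj G] supplies the other. *)
Lemma embedding_H4E (T : finType) (G : sgraph T) (d : T) (f : {ffun 'I_4 -> T}) :
  let t := mktuple f in
  embedding H4 G f =
  injectiveb f && H4_pattern (adj G) (nth d t 0) (nth d t 1) (nth d t 2) (nth d t 3).
Proof.
move=> t; rewrite /embedding; congr andb.
pose o k (ltk : (k < 4)%N) : 'I_4 := Ordinal ltk.
have tE k (ltk : (k < 4)%N) : nth d t k = f (o k ltk).
  by rewrite -[k]/(val (o k ltk)) nth_mktuple.
rewrite (tE 0%N isT) (tE 1%N isT) (tE 2 isT) (tE 3 isT).
apply/andP/and4P => [[/forallP hr /forallP hb]|[h02 h01 h03 h13]].
  have adjP x y : adj H4_red x y -> adj G (f x) (f y).
    by have /forallP/(_ y)/implyP := hr x.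
  have nadjP x y : adj H4_blue x y -> ~~ adj G (f x) (f y).
    by have /forallP/(_ y)/implyP := hb x.
  by split; [apply: adjP|apply: nadjP|apply: nadjP|apply: nadjP];
    rewrite adj_sgraph_of.
split; apply/forallP => x; apply/forallP => y; rewrite adj_sgraph_of;
  apply/implyP; case: x => [[|[|[|[|x]]]] ltx] //;
  case: y => [[|[|[|[|y]]]] lty] // _;
  rewrite (bool_irrelevance ltx isT) (bool_irrelevance lty isT) //;
  by rewrite adj_sym.
Qed.

Lemma num_homsE (T : finType) (r : rel T) (d : T) :
  num_homs r d = \sum_(f : {ffun 'I_4 -> T})
    let t := mktuple f in
    H4_pattern r (nth d t 0) (nth d t 1) (nth d t 2) (nth d t 3).
Proof.
rewrite /num_homs (reindex (fun f : {ffun 'I_4 -> T} => mktuple f)).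
  exact: eq_bigr.
exists (fun t => [ffun i => tnth t i]) => [f|t] _.
  by apply/ffunP => i; rewrite ffunE tnth_mktuple.
by apply: eq_from_tnth => i; rewrite tnth_mktuple ffunE.
Qed.

Lemma num_embeddingsE (T : finType) (G : sgraph T) :
  num_embeddings H4 G = \sum_(f : {ffun 'I_4 -> T}) embedding H4 G f.
Proof. by rewrite -big_mkcond sum1_card. Qed.

Lemma num_embeddings_le (T : finType) (G : sgraph T) (d : T) :
  (num_embeddings H4 G <= num_homs (adj G) d)%N.
Proof.
rewrite num_embeddingsE num_homsE; apply: leq_sum => f _.
by rewrite (embedding_H4E G d); case: injectiveb.
Qed.

(** A colour-respecting map that is not an embedding is not injective, and there are n^4 minus
    [n ^_ 4] non-injective maps. *)
Lemma num_homs_le (T : finType) (G : sgraph T) (d : T) :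
  (num_homs (adj G) d + #|T| ^_ 4 <= num_embeddings H4 G + #|T| ^ 4)%N.
Proof.
have <- : #|[set f : {ffun 'I_4 -> T} | injectiveb f]| = (#|T| ^_ 4)%N.
  by rewrite card_inj_ffuns card_ord.
have <- : #|{ffun 'I_4 -> T}| = (#|T| ^ 4)%N by rewrite card_ffun card_ord.
rewrite -sum1_card big_mkcond -sum1_card num_embeddingsE num_homsE -!big_split.
apply: leq_sum => f _; rewrite (embedding_H4E G d) inE.
by rewrite /=; case: injectiveb; case: H4_pattern.
Qed.

Lemma big_mul4 (T : finType) (f0 f1 f2 f3 : T -> nat) :
  (\sum_x0 \sum_x1 \sum_x2 \sum_x3 f0 x0 * f1 x1 * f2 x2 * f3 x3 =
  (\sum_x f0 x) * (\sum_x f1 x) * (\sum_x f2 x) * (\sum_x f3 x))%N.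
Proof.
rewrite -!mulnA big_distrl; apply: eq_bigr => x0 _ /=.
rewrite big_distrl [RHS]big_distrr; apply: eq_bigr => x1 _ /=.
rewrite big_distrl mulnA [RHS]big_distrr; apply: eq_bigr => x2 _ /=.
by rewrite mulnA [RHS]big_distrr; apply: eq_bigr => x3 _; rewrite /= ?mulnA.
Qed.

(** Vertices 0, 1, 3 of [H4] are pairwise blue and go to one part, vertex 2 to the other: a^3 b +
    b^3 a maps. *)
Lemma num_homs_bip (T : finType) (A : {set T}) (d : T) :
  num_homs (adj (bip_graph A)) d =
  (#|A| * #|~: A| * (#|A| ^ 2 + #|~: A| ^ 2))%N.
Proof.
have cardE (B : {set T}) : (\sum_x (x \in B))%N = #|B|.
  by rewrite -big_mkcond sum1_card.
rewrite /num_homs (big_tuple4 (fun t : seq T =>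
  H4_pattern _ (nth d t 0) (nth d t 1) (nth d t 2) (nth d t 3) : nat)) /=.
transitivity (#|A| * #|A| * #|~: A| * #|A|
              + #|~: A| * #|~: A| * #|A| * #|~: A|)%N; last lia.
rewrite -!cardE -!big_mul4 -big_split; apply: eq_bigr => x0 _ /=.
rewrite -big_split; apply: eq_bigr => x1 _ /=.
rewrite -big_split; apply: eq_bigr => x2 _ /=.
rewrite -big_split; apply: eq_bigr => x3 _ /=.
rewrite /H4_pattern !adj_sgraph_of /bip_rel !inE.
by do 4!case: (_ \in A).
Qed.

Local Open Scope classical_set_scope.
Local Open Scope ring_scope.

(** * Limits *)

Section Limits.
Variable R : realType.

Lemma cvg_invn : (fun n : nat => n%:R^-1 : R) @ \oo --> (0 : R).
Proof.
apply/(@gtr0_cvgV0 R nat \oo _ (fun n => n%:R)); last exact: cvgr_idn.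
by apply: filterS (nbhs_infty_ge 1) => n n0; rewrite ltr0n.
Qed.

Lemma cvg_ffact_ratio (m : nat) :
  (fun n : nat => (n ^_ m)%N%:R / (n ^ m)%N%:R : R) @ \oo --> (1 : R).
Proof.
elim: m => [|m IHm].
  by under eq_fun do rewrite ffactn0 expn0 divr1; exact: cvg_cst.
(* Passing from m to m+1 multiplies the ratio by (n - m) / n. *)
have : (fun n : nat => (n ^_ m)%N%:R / (n ^ m)%N%:R * (1 - m%:R * n%:R^-1) : R)
    @ \oo --> (1 * (1 - m%:R * 0) : R).
  by apply: cvgM => //; apply: cvgB; [exact: cvg_cst|apply: cvgMr; exact: cvg_invn].
rewrite mulr0 subr0 mulr1; apply: cvg_trans; apply: near_eq_cvg.
apply: filterS (nbhs_infty_ge m.+1) => n ltmn.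
have n0 : n%:R != 0 :> R by rewrite pnatr_eq0; lia.
rewrite ffactnSr expnSr !natrM natrB; last exact: ltnW.
have nm0 : (n ^ m)%N%:R != 0 :> R by rewrite natrX expf_neq0.
by field; rewrite n0.
Qed.

Lemma emb_density_upper (T : finType) (G : sgraph T) :
  emb_density R H4 G <= 1 / 8 * ((#|T| ^_ 4)%N%:R / (#|T| ^ 4)%N%:R)^-1.
Proof.
rewrite /emb_density card_ord invf_div mulrA.
apply: ler_wpM2r; first by rewrite invr_ge0 ler0n.
rewrite mul1r mulrC ler_pdivlMr ?ltr0n // -natrM ler_nat.
(* The counting bound needs a default vertex, so the empty graph is treated apart. *)
have [T0|] := posnP #|T|.
  rewrite /num_embeddings eq_card0 // => f; apply/negbTE.
  by have := fintype0 (f ord0) T0.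
case/card_gt0P => d _; have T0 : (0 < #|T|)%N by apply/card_gt0P; exists d.
have := leq_trans (leq_addl _ _) (nonsharp_count d (adj_irr G) (adj_sym G)).
rewrite -/(num_homs (adj G) d); have := num_embeddings_le G d.
move: (num_embeddings H4 G) (num_homs (adj G) d) => e h leh.
rewrite expnS [(75 * _)%N]mulnCA [(600 * _)%N]mulnCA leq_pmul2l //.
by lia.
Qed.

(** * Asymptotic optimality of balanced complete bipartite graphs *)

Lemma bip_density_cvg (V : nat -> finType) (A : forall k, {set V k}) :
  (fun k => #|V k|) @ \oo --> \oo ->
  (fun k => #|A k|%:R / #|V k|%:R : R) @ \oo --> (1 / 2 : R) ->
  (fun k => #|~: A k|%:R / #|V k|%:R : R) @ \oo --> (1 / 2 : R) ->
  (fun k => emb_density R H4 (bip_graph (A k))) @ \oo --> (1 / 8 : R).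
Proof.
move=> Voo; set a := fun k => _ / _ : R; move=> ca; set b := fun k => _ / _ : R; move=> cb.
pose rho k := (#|V k| ^_ 4)%N%:R / (#|V k| ^ 4)%N%:R : R.
have crho : rho @ \oo --> (1 : R).
  exact: (cvg_comp _ _ Voo (@cvg_ffact_ratio 4)).
have crhoV : (fun k => (rho k)^-1) @ \oo --> (1 : R).
  by rewrite -invr1; apply: cvgV => //; rewrite oner_neq0.
pose u k := a k * b k * (a k * a k + b k * b k) / rho k.
have cu : u @ \oo --> (1 / 8 : R).
  rewrite (_ : 1 / 8 = 1 / 2 * (1 / 2) * (1 / 2 * (1 / 2) + 1 / 2 * (1 / 2)) * 1); last by field.
  by apply: cvgM => //; apply: cvgM; [exact: cvgM|apply: cvgD; exact: cvgM].
(* Here [u k] is the number of colour-respecting maps over [n ^_ 4]; embeddings fall short of it by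
   at most the non-injective maps, a fraction [(rho k)^-1 - 1]. *)
apply: (@squeeze_cvgr _ _ _ _ (fun k => u k + 1 - (rho k)^-1) u) => //; last first.
  rewrite (_ : 1 / 8 = 1 / 8 + 1 - 1); last by field.
  by apply: cvgB => //; apply: cvgD => //; exact: cvg_cst.
have /cvgnyPge/(_ 4) := Voo; apply: filterS => k V4.
have /card_gt0P[d _] : (0 < #|V k|)%N by apply: leq_trans V4.
have n0 : #|V k|%:R != 0 :> R by rewrite pnatr_eq0; lia.
have f0 : (0 : R) < (#|V k| ^_ 4)%N%:R by rewrite ltr0n ffact_gt0.
have uE : u k = (num_homs (adj (bip_graph (A k))) d)%:R / (#|V k| ^_ 4)%N%:R.
  move: f0; rewrite num_homs_bip /u /a /b /rho; set f := (_ ^_ _)%N%:R => f0.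
  by rewrite !(natrM, natrD, natrX); field; rewrite n0 gt_eqF.
have rhoE : (rho k)^-1 = (#|V k| ^ 4)%N%:R / (#|V k| ^_ 4)%N%:R by rewrite /rho invf_div.
rewrite uE rhoE /emb_density card_ord; apply/andP; split.
  rewrite -[X in _ + X - _](divff (lt0r_neq0 f0)) -mulrDl -mulrBl ler_pM2r ?invr_gt0 //.
  by rewrite lerBlDr -!natrD ler_nat num_homs_le.
by rewrite ler_pM2r ?invr_gt0 // ler_nat num_embeddings_le.
Qed.

Definition half_set (n : nat) : {set 'I_n} := [set i : 'I_n | (i < n./2)%N]%SET.

Lemma card_half_set (n : nat) : #|half_set n| = n./2.
Proof.
rewrite /half_set -sum1dep_card -(big_ord_widen n (fun=> 1%N)) ?sum1_card ?card_ord //.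
by lia.
Qed.

Lemma cvg_half : (fun n : nat => n./2%:R / n%:R : R) @ \oo --> (1 / 2 : R).
Proof.
apply: (@squeeze_cvgr _ _ _ _ (fun n : nat => 1 / 2 - n%:R^-1) (fun=> 1 / 2)).
- apply: filterS (nbhs_infty_ge 1) => n n1.
  have n0 : (0 : R) < n%:R by rewrite ltr0n.
  have nE : n%:R = (odd n)%:R + n./2%:R * 2 :> R.
    by rewrite -natrM -natrD muln2 odd_double_half.
  have o1 : (odd n)%:R <= 1 :> R by case: odd.
  have o0 : 0 <= (odd n)%:R :> R by rewrite ler0n.
  rewrite ler_pdivlMr // ler_pdivrMr // mulrBl mulVf ?gt_eqF //.
  by apply/andP; split; lra.
- rewrite -[X in _ --> X]subr0; apply: cvgB; [exact: cvg_cst|exact: cvg_invn].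
- exact: cvg_cst.
Qed.

Lemma max_density_cvg : max_emb_density R H4 @ \oo --> (1 / 8 : R).
Proof.
apply: (@squeeze_cvgr _ _ _ _ (fun n => emb_density R H4 (bip_graph (half_set n)))
  (fun n => 1 / 8 * ((n ^_ 4)%N%:R / (n ^ 4)%N%:R)^-1)).
- near=> n; apply/andP; split; first exact: le_bigmax.
  apply: bigmax_le => [|G _].
    by rewrite mulr_ge0 ?invr_ge0 ?divr_ge0.
  by have := emb_density_upper G; rewrite card_ord.
- apply: bip_density_cvg.
  + by under eq_fun do rewrite card_ord; exact: cvg_id.
  + by under eq_fun do rewrite card_half_set card_ord; exact: cvg_half.
  + have : (fun n : nat => 1 - n./2%:R / n%:R : R) @ \oo --> (1 - 1 / 2 : R).
      by apply: cvgB; [exact: cvg_cst|exact: cvg_half].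
    rewrite (_ : 1 - 1 / 2 = 1 / 2); last by field.
    apply: cvg_trans; apply: near_eq_cvg.
    apply: filterS (nbhs_infty_ge 1) => n n1.
    rewrite cardsCs finset.setCK card_half_set card_ord natrB; last by lia.
    by rewrite mulrBl divff // pnatr_eq0; lia.
- rewrite -[X in _ --> X]mulr1; apply: cvgM; first exact: cvg_cst.
  by rewrite -[X in _ --> X]invr1; apply: cvgV; [rewrite oner_neq0|exact: cvg_ffact_ratio].
Unshelve. all: by end_near. Qed.

Lemma inducibility_H4 : inducibility R H4 = 1 / 8.
Proof. by apply: cvg_lim => //; exact: max_density_cvg. Qed.

(** * Subgraphs of positive density in maximising sequences *)

Lemma nonsharp_density_le (W T : finType) (F : sgraph W) (G : sgraph T) (d : W) :
    #|W| = 5%N -> ~~ sharp (pattern_of (adj F) d (enum W)) -> (5 <= #|T|)%N ->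
  induced_density R F G / 120 * ((#|T| ^_ 5)%N%:R / (#|T| ^ 5)%N%:R) <=
  75 - 600 * (emb_density R H4 G * ((#|T| ^_ 4)%N%:R / (#|T| ^ 4)%N%:R)).
Proof.
move=> W5 nsF T5; have /card_gt0P[d' _] : (0 < #|T|)%N by apply: leq_trans T5.
have := nonsharp_count d' (adj_irr G) (adj_sym G); rewrite -/(num_homs (adj G) d').
have := induced_copies_le G d' W5 nsF; have := num_embeddings_le G d'.
rewrite /induced_density /emb_density W5 card_ord -bin_ffact.
set N := #|_|; set h := num_homs _ _; set B := (\sum_t _)%N; set e := num_embeddings _ _.
move=> leh leN leB.
have n0 : (0 : R) < #|T|%:R by rewrite ltr0n; lia.
have C0 : (0 : R) < 'C(#|T|, 5)%:R by rewrite ltr0n bin_gt0.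
have f0 : (0 : R) < (#|T| ^_ 4)%N%:R by rewrite ltr0n ffact_gt0; lia.
have leR : N%:R + 600 * (#|T|%:R * e%:R) <= 75 * #|T|%:R ^+ 5 :> R.
  rewrite -natrX -!natrM -natrD ler_nat; apply: leq_trans leB.
  by rewrite leq_add // !leq_mul2l leh !orbT.
(* The factor 120 = 5! turns the binomial normalisation of [induced_density] into a falling
   factorial. *)
rewrite [5`!%N](_ : _ = 120%N) //; set f := (_ ^_ _)%N%:R in f0 *.
rewrite natrM !natrX; move: n0 C0 leR; set n := #|T|%:R; set C := 'C(_, _)%:R.
move=> n0 C0 leR.
have -> : N%:R / C / 120 * (C * 120%:R / n ^+ 5) = N%:R / n ^+ 5.
  by field; rewrite !gt_eqF.
have -> : 75 - 600 * (e%:R / f * (f / n ^+ 4)) =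
    (75 * n ^+ 5 - 600 * (n * e%:R)) / n ^+ 5.
  by field; rewrite !gt_eqF.
by rewrite ler_pM2r ?invr_gt0 ?exprn_gt0 // lerBrDr.
Qed.

Lemma positive_density_sharp (V : nat -> finType) (G : forall k, sgraph (V k))
    (W : finType) (F : sgraph W) (d : W) (c : R) :
  (fun k => #|V k|) @ \oo --> \oo ->
  (fun k => emb_density R H4 (G k)) @ \oo --> (1 / 8 : R) ->
  #|W| = 5%N -> 0 < c ->
  (\forall k \near \oo, c <= induced_density R F (G k)) ->
  sharp (pattern_of (adj F) d (enum W)).
Proof.
move=> Voo cG W5 c0 cF; apply: contraT => nsF.
have ratio m : (fun k => (#|V k| ^_ m)%N%:R / (#|V k| ^ m)%N%:R : R) @ \oo --> (1 : R).
  exact: (cvg_comp _ _ Voo (@cvg_ffact_ratio m)).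
(* In the limit the right-hand side is 75 - 600 / 8 = 0, which contradicts c > 0. *)
suff : c / 120 * 1 <= 75 - 600 * (1 / 8 * 1) by lra.
apply: (@ler_cvg_to _ \oo _ _
  (fun k => c / 120 * ((#|V k| ^_ 5)%N%:R / (#|V k| ^ 5)%N%:R))
  (fun k => 75 - 600 * (emb_density R H4 (G k)
     * ((#|V k| ^_ 4)%N%:R / (#|V k| ^ 4)%N%:R)))).
- by apply: cvgM; [exact: cvg_cst|exact: ratio].
- apply: cvgB; first exact: cvg_cst.
  by apply: cvgM; [exact: cvg_cst|apply: cvgM; [|exact: ratio]].
have /cvgnyPge/(_ 5) := Voo; apply: filterS2 cF => k cF V5.
apply: le_trans (nonsharp_density_le (G k) W5 nsF V5).
by rewrite ler_wpM2r ?divr_ge0 // ler_pM2r ?invr_gt0.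
Qed.
End Limits.

Theorem theorem3p13 (R : realType) :
  [/\ cvgn (max_emb_density R H4) /\ inducibility R H4 = 1 / 8,
      forall (V : nat -> finType) (A : forall k, {set V k}),
        (fun k => #|V k|) @ \oo --> \oo ->
        (fun k => #|A k|%:R / #|V k|%:R : R) @ \oo --> (1 / 2 : R) ->
        (fun k => #|~: A k|%:R / #|V k|%:R : R) @ \oo --> (1 / 2 : R) ->
        (fun k => emb_density R H4 (bip_graph (A k))) @ \oo
          --> inducibility R H4
    & forall (V : nat -> finType) (G : forall k, sgraph (V k))
        (W : finType) (F : sgraph W),
        (fun k => #|V k|) @ \oo --> \oo ->
        (fun k => emb_density R H4 (G k)) @ \oo --> inducibility R H4 ->
        #|W| = 5%N ->
        (exists2 c : R, 0 < c &
          \forall k \near \oo, c <= induced_density R F (G k)) ->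
        complete_bipartite F \/
        (exists2 K : sgraph 'I_4, complete_bipartite K &
          isomorphic F (add_isolated K))].
Proof.
rewrite inducibility_H4; split.
- by split=> //; apply/cvg_ex; exists (1 / 8); exact: max_density_cvg.
- exact: bip_density_cvg.
- move=> V G W F Voo cG W5 [c c0 cF].
  have /card_gt0P[d _] : (0 < #|W|)%N by rewrite W5.
  exact: (sharp_classification W5 (positive_density_sharp d Voo cG W5 c0 cF)).
Qed.
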